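(* Let $G$ be a fixed edge-ordered graph with minimal edge $e_0$ and maximal edge $e_{\max}$. If $e_0$ and $e_{\max}$ are both isolated in $G$, then $ssat_e(n,G)=O(1)$; otherwise $ssat_e(n,G)=\Omega(n)$.
   Context: An edge-ordered graph is a finite simple graph together with a linear order on its edge set (usually given by an injective labeling $l:E\to\mathbb{N}$ or $l:E\to\mathbb{R}$). A copy of $G$ in an edge-ordered graph $H$ is a subgraph of $H$ (with the induced edge-order) isomorphic to $G$ by an isomorphism respecting the edge-order. The minimal (maximal) edge is the edge with the smallest (largest) label; an edge is isolated if it shares no vertex with any other edge. $ssat_e(n,G)$ is the minimum number of edges in an edge-ordered graph $H$ on $n$ vertices (not required to be $G$-free) such that adding to $H$ any missing edge, inserted at an arbitrary position of the linear order of the edges, creates a new copy of $G$ (one using the added edge); that is, for every missing edge and every position a new copy is created. Asymptotic notation is for $n\to\infty$ with $G$ fixed ($n$ is assumed large enough). *)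

(* Defs.v *)
From mathcomp Require Import all_boot.
From mathcomp Require Import boolp.

Set Implicit Arguments.
Unset Strict Implicit.
Unset Printing Implicit Defensive.

(* The values of [ele] outside the edge set are irrelevant: every definition
   below only looks at [ele] between edges. *)
Record eograph (V : finType) := EOGraph {
  edges : {set {set V}};
  ele : rel {set V};
  card_edge : forall e, e \in edges -> #|e| = 2;
  ele_anti : {in edges &, antisymmetric ele};
  ele_trans : {in edges & &, transitive ele};
  ele_total : {in edges &, total ele}
}.

Definition min_edge (V : finType) (G : eograph V) (e : {set V}) : Prop :=
  e \in edges G /\ {in edges G, forall e', ele G e e'}.

Definition max_edge (V : finType) (G : eograph V) (e : {set V}) : Prop :=
  e \in edges G /\ {in edges G, forall e', ele G e' e}.

Definition isolated_edge (V : finType) (G : eograph V) (e : {set V}) : Prop :=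
  e \in edges G /\ {in edges G, forall e', e' != e -> [disjoint e' & e]}.

(* The subgraph (S, F) of H, with the edge order induced by H, is isomorphic
   to G. *)
Definition is_copy (U V : finType) (G : eograph U) (H : eograph V)
    (S : {set V}) (F : {set {set V}}) : Prop :=
  F \subset edges H /\
  exists phi : U -> V,
    [/\ injective phi,
        S = phi @: [set: U],
        F = [set phi @: e | e : {set U} in edges G] &
        {in edges G &, forall e e' : {set U},
           ele H (phi @: e) (phi @: e') = ele G e e'}].

Definition missing_edge (V : finType) (H : eograph V) (f : {set V}) : Prop :=
  #|f| = 2 /\ f \notin edges H.

(* H' is H plus the edge f; the position of f in the order of H' is free, so
   quantifying over H' is quantifying over all positions of f. *)
Definition edge_insertion (V : finType) (H : eograph V) (f : {set V})
    (H' : eograph V) : Prop :=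
  edges H' = f |: edges H /\
  {in edges H &, forall e e', ele H' e e' = ele H e e'}.

Definition semisaturated (U V : finType) (G : eograph U) (H : eograph V)
    : Prop :=
  forall f, missing_edge H f ->
  forall H', edge_insertion H f H' ->
  exists S F, is_copy G H' S F /\ f \in F.

Definition semisat_size (U : finType) (G : eograph U) (n m : nat) : Prop :=
  exists2 H : eograph 'I_n, semisaturated G H & #|edges H| = m.

Lemma complete_eograph (V : finType) :
  exists H : eograph V, forall f : {set V}, #|f| = 2 -> f \in edges H.
Proof.
pose E : {set {set V}} := [set e : {set V} | #|e| == 2].
pose r : rel {set V} := fun e e' => enum_rank e <= enum_rank e'.
have cardE e : e \in E -> #|e| = 2 by rewrite inE => /eqP.
have antiE : {in E &, antisymmetric r}.
  by move=> e e' _ _ /anti_leq /val_inj /enum_rank_inj.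
have transE : {in E & &, transitive r}.
  by move=> e e' e'' _ _ _; apply: leq_trans.
have totalE : {in E &, total r} by move=> e e' _ _; apply: leq_total.
by exists (EOGraph cardE antiE transE totalE) => f /= f2; rewrite inE f2.
Qed.

(* A complete graph has no missing edge, so it is vacuously semisaturated and
   the minimum in [ssat_e] is over a nonempty set. *)
Lemma semisat_size_exists (U : finType) (G : eograph U) (n : nat) :
  exists m, `[< semisat_size G n m >].
Proof.
have [H Hall] := complete_eograph 'I_n.
exists #|edges H|; apply/asboolP; exists H => // f [f2].
by rewrite Hall.
Qed.

Definition ssat_e (n : nat) (U : finType) (G : eograph U) : nat :=
  ex_minn (semisat_size_exists G n).

(* Main.v *)
(* Lower bound: if e0 is not isolated, insert the missing edge f below all edges
   of H. In a new copy f must play e0, hence f meets an edge of H; so H has at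
   most one isolated vertex. Reversing the order handles emax.
   Upper bound: H is complete on 4|U| vertices and empty elsewhere, its order
   making the four blocks low, low, high, high copies of G with every low edge
   below every high one. A missing edge f has at most one vertex in the clique,
   so it misses a low and a high block. Either f lies below the whole high copy
   and can replace its e0, or above the whole low copy and can replace its
   emax. *)

Require Import Defs.
From mathcomp Require Import all_boot all_order all_algebra.
From mathcomp Require Import all_classical all_reals all_analysis.
From mathcomp Require Import zify.
Import Order.TTheory GRing.Theory Num.Theory.
Import numFieldNormedType.Exports.

Set Implicit Arguments.
Unset Strict Implicit.
Unset Printing Implicit Defensive.

(** * Reversal of the edge order *)

Section Flip.
Context {V : finType} (H : eograph V).

Lemma flip_anti : {in edges H &, antisymmetric (fun e e' => ele H e' e)}.
Proof. by move=> e e' He He'; rewrite andbC; apply: ele_anti. Qed.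

Lemma flip_trans : {in edges H & &, transitive (fun e e' => ele H e' e)}.
Proof.
by move=> e2 e1 e3 H2 H1 H3 r12 r23; apply: (@ele_trans _ H e2).
Qed.

Lemma flip_total : {in edges H &, total (fun e e' => ele H e' e)}.
Proof. by move=> e e' He He'; apply: ele_total. Qed.

Definition flip : eograph V :=
  EOGraph (@card_edge V H) flip_anti flip_trans flip_total.

End Flip.

Lemma ele_refl {V : finType} (H : eograph V) (e : {set V}) :
  e \in edges H -> ele H e e.
Proof. by move=> He; have := ele_total He He; rewrite orbb. Qed.

Lemma edge_insertion_flip {V : finType} (H H' : eograph V) (f : {set V}) :
  edge_insertion H f H' -> edge_insertion (flip H) f (flip H').
Proof.
by case=> eqE eqr; split=> // e e' He He' /=; rewrite eqr.
Qed.

Lemma is_copy_flip {U V : finType} (G : eograph U) (H : eograph V) S F :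
  is_copy G H S F -> is_copy (flip G) (flip H) S F.
Proof.
case=> sF [phi [phi_inj eqS eqF eqr]]; split=> //.
by exists phi; split=> // e e' He He' /=; rewrite eqr.
Qed.

(** A position for [f] in the reversed order mirrors one in the original order, and reversal turns
    the copy found there into the required one. This carries the lower bound over from minimal to
    maximal edges. *)
Lemma semisaturated_flip {U V : finType} (G : eograph U) (H : eograph V) :
  semisaturated G H -> semisaturated (flip G) (flip H).
Proof.
move=> sat f mf H' /edge_insertion_flip [eqE eqr].
have [|S [F [[sF [phi [phi_inj eqS eqF eqr']]] fF]]] := sat f mf (flip H').
  by split.
exists S, F; split=> //; split=> //; exists phi; split=> // e e' He He' /=.
by rewrite -eqr'.
Qed.

(** * The linear lower bound *)

Lemma insertion_bottom {V : finType} (H : eograph V) (f : {set V}) :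
  missing_edge H f ->
  exists2 H', edge_insertion H f H' & {in edges H', forall e, ele H' f e}.
Proof.
case=> f2 fN; pose E := f |: edges H.
(* The guard [e' != f] keeps other edges from lying below [f]: [ele H] is arbitrary there, as [f] is
   no edge of [H]. *)
pose r : rel {set V} := fun e e' => (e == f) || (e' != f) && ele H e e'.
have inE' e : e \in E -> e != f -> e \in edges H.
  by rewrite !inE => /orP[->|].
have cardE e : e \in E -> #|e| = 2.
  by rewrite !inE => /orP[/eqP ->//|/card_edge].
have antiE : {in E &, antisymmetric r}.
  move=> x y /inE' Hx /inE' Hy; rewrite /r.
  case: eqVneq Hx => [-> _|_ Hx] /=; first by rewrite orbF => /eqP.
  case: eqVneq Hy => [//|_ Hy] /=.
  by apply: ele_anti; [apply: Hx | apply: Hy].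
have transE : {in E & &, transitive r}.
  move=> y x z /inE' Hy /inE' Hx /inE' Hz; rewrite /r.
  case: eqVneq Hx => [//|_ Hx] /=.
  case: eqVneq Hy => [//|_ Hy] /=.
  case: eqVneq Hz => [//|_ Hz] /=.
  by apply: ele_trans; [apply: Hy | apply: Hx | apply: Hz].
have totalE : {in E &, total r}.
  move=> x y /inE' Hx /inE' Hy; rewrite /r.
  case: eqVneq Hx => [//|_ Hx] /=.
  case: eqVneq Hy => [//|_ Hy] /=.
  by apply: ele_total; [apply: Hx | apply: Hy].
exists (EOGraph cardE antiE transE totalE);
  last by move=> e _ /=; rewrite /r eqxx.
split=> //= e e' He He'; rewrite /r.
have neq x : x \in edges H -> (x == f) = false.
  by move=> Hx; apply: contraNF fN => /eqP <-.
by rewrite !neq.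
Qed.

(** With [f] inserted at the bottom, antisymmetry forces its preimage in the new copy to be [e0]. An
    edge meeting [e0] is then sent to an edge that meets [f] and differs from it by injectivity,
    hence lies in [H]. *)
Lemma semisaturated_touch {U V : finType} (G : eograph U) (H : eograph V)
    (e0 : {set U}) (f : {set V}) :
  min_edge G e0 -> ~ isolated_edge G e0 -> semisaturated G H ->
  missing_edge H f -> exists2 e, e \in edges H & ~~ [disjoint e & f].
Proof.
move=> [e0E e0min] Niso sat mf.
have [e1 e1E /andP[e1N /pred0Pn[u /andP[/= ue1 ue0]]]] :
    exists2 e, e \in edges G & (e != e0) && ~~ [disjoint e & e0].
  apply: contrapT => noE; apply: Niso; split=> // e eE eN.
  by apply: contrapT => /negP ee0; apply: noE; exists e; rewrite ?eN.
have [H' ins fmin] := insertion_bottom mf.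
have [S [F [[sF [phi [phi_inj _ eqF eqr]]] fF]]] := sat f mf H' ins.
have phiE (e : {set U}) : e \in edges G -> phi @: e \in edges H'.
  by move=> eE; apply: (fintype.subsetP sF); rewrite eqF imset_f.
move: fF; rewrite eqF => /imsetP[e eE fe].
have ee0 : e = e0.
  by apply: (@ele_anti _ G) => //; rewrite -eqr // -fe fmin ?phiE //= e0min.
exists (phi @: e1); last first.
  by apply/pred0Pn; exists (phi u); rewrite /= fe ee0 !imset_f.
have := phiE _ e1E; rewrite ins.1 !inE fe ee0.
by rewrite (inj_eq (imset_inj phi_inj)) (negPf e1N).
Qed.

(** Edges cover at most [2 * #|edges H|] vertices. Two uncovered vertices would form a missing edge
    disjoint from all edges, so at most one vertex remains. *)
Lemma edges_lower_bound {V : finType} (H : eograph V) :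
  (forall f, missing_edge H f ->
     exists2 e, e \in edges H & ~~ [disjoint e & f]) ->
  #|V| <= #|edges H|.*2.+1.
Proof.
move=> touch.
rewrite -(cardsC (finset.cover (edges H))) -addn1; apply: leq_add.
  apply: leq_trans (leq_card_cover _) _.
  rewrite (eq_bigr (fun=> 2)) => [|e]; last exact: card_edge.
  by rewrite sum_nat_const muln2.
apply/card_le1_eqP => x y xN yN; apply: contrapT => /eqP neq.
have outside z e : z \in ~: finset.cover (edges H) -> e \in edges H -> z \notin e.
  rewrite inE => zN eE; apply: contra zN => ze.
  by apply/bigcupP; exists e.
have [|e eE] := touch [set x; y].
  split; first by rewrite cards2 eq_sym neq.
  by apply/negP => /(outside x _ xN); rewrite !inE eqxx.
case/pred0Pn=> z /andP[/= ze]; rewrite !inE => /orP[] /eqP zE.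
  by have := outside x e xN eE; rewrite -zE ze.
by have := outside y e yN eE; rewrite -zE ze.
Qed.

Lemma semisaturated_lower_bound {U V : finType} (G : eograph U)
    (H : eograph V) (e0 emax : {set U}) :
  min_edge G e0 -> max_edge G emax ->
  ~ (isolated_edge G e0 /\ isolated_edge G emax) -> semisaturated G H ->
  #|V| <= #|edges H|.*2.+1.
Proof.
move=> min0 max1 Niso sat; apply: edges_lower_bound => f mf.
have [iso0|Niso0] := pselect (isolated_edge G e0); last first.
  exact: semisaturated_touch min0 Niso0 sat mf.
(* Isolation ignores the order, so it passes to [flip G], where [emax] is minimal. *)
have Niso1 : ~ isolated_edge (flip G) emax by move=> iso1; apply: Niso.
exact: (@semisaturated_touch _ _ (flip G) (flip H) emax f max1 Niso1
  (semisaturated_flip sat) mf).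
Qed.

(** * Moving an extremal edge onto [f] *)

(* Isolation of [e0] lets the image of [e0] be moved onto [f] without changing
   the image of any other edge. *)
Lemma copy_through_min {U V : finType} (G : eograph U) (H : eograph V)
    (e0 : {set U}) (f : {set V}) (phi : U -> V) :
  min_edge G e0 -> isolated_edge G e0 -> injective phi -> f \in edges H ->
  (forall u, phi u \notin f) ->
  {in edges G, forall e : {set U}, phi @: e \in edges H} ->
  {in edges G &, forall e e' : {set U}, ele H (phi @: e) (phi @: e') = ele G e e'} ->
  {in edges G, forall e : {set U}, ele H f (phi @: e)} ->
  exists S F, is_copy G H S F /\ f \in F.
Proof.
move=> [e0E e0min] [_ iso] phi_inj fE phiN phiE phir fmin.
have /cards2P[a [b [aNb e0ab]]] : #|e0| == 2 by rewrite (card_edge e0E).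
have /cards2P[x [y [xNy fxy]]] : #|f| == 2 by rewrite (card_edge fE).
(* Only the endpoints [a], [b] of [e0] are rerouted, to the endpoints of [f]; since [phi] avoids
   [f], [psi] stays injective. *)
pose psi u := if u == a then x else if u == b then y else phi u.
have xN u : (x == phi u) = false.
  by apply: contraNF (phiN u) => /eqP <-; rewrite fxy !inE eqxx.
have yN u : (y == phi u) = false.
  by apply: contraNF (phiN u) => /eqP <-; rewrite fxy !inE eqxx orbT.
have psi_inj : injective psi.
  move=> u v /eqP; rewrite /psi.
  have [->|uNa] := eqVneq u a; have [->|vNa] := eqVneq v a => //.
  - by case: (v == b); rewrite /= ?xN ?(negPf xNy).
  - by case: (u == b); rewrite /= eq_sym ?xN ?(negPf xNy).
  have [->|uNb] := eqVneq u b; have [->|vNb] := eqVneq v b => //=.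
  - by rewrite yN.
  - by rewrite eq_sym yN.
  by move/eqP/phi_inj.
have psi0 : psi @: e0 = f.
  by rewrite e0ab imsetU !imset_set1 /psi !eqxx eq_sym (negPf aNb) fxy.
have psi1 e : e \in edges G -> e != e0 -> psi @: e = phi @: e.
  move=> eE eN; apply: eq_in_imset => u ue.
  have := negbT (disjointFr (iso e eE eN) ue).
  by rewrite e0ab !inE negb_or /psi => /andP[/negPf -> /negPf ->].
have phiNf e : e \in edges G -> phi @: e != f.
  move=> eE; apply/eqP => ef.
  have /card_gt0P[u ue] : 0 < #|e| by rewrite (card_edge eE).
  by have := phiN u; rewrite -ef imset_f.
pose F := [set psi @: e | e : {set U} in edges G].
exists (psi @: [set: U]), F; split; last by rewrite -psi0 imset_f.
split.
  apply/fintype.subsetP => _ /imsetP[e eE ->].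
  have [->|eN] := eqVneq e e0; first by rewrite psi0.
  by rewrite psi1 ?phiE.
exists psi; split=> // e e' eE eE'.
have [->|eN] := eqVneq e e0; have [->|eN'] := eqVneq e' e0.
- by rewrite psi0 !ele_refl.
- by rewrite psi0 psi1 ?fmin ?e0min.
(* Both sides are [false]: [e0] and [f] lie below the edges compared with them, so a converse
   comparison would give equality by antisymmetry. *)
- rewrite psi0 psi1 //; transitivity false; last apply/esym.
    apply: contraNF (phiNf e eE) => le_f; apply/eqP.
    by apply: (@ele_anti _ H); rewrite ?phiE // le_f fmin.
  apply: contraNF eN => le_0; apply/eqP.
  by apply: (@ele_anti _ G); rewrite // le_0 e0min.
by rewrite !psi1 ?phir.
Qed.

Lemma copy_through_max {U V : finType} (G : eograph U) (H : eograph V)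
    (emax : {set U}) (f : {set V}) (phi : U -> V) :
  max_edge G emax -> isolated_edge G emax -> injective phi -> f \in edges H ->
  (forall u, phi u \notin f) ->
  {in edges G, forall e : {set U}, phi @: e \in edges H} ->
  {in edges G &, forall e e' : {set U}, ele H (phi @: e) (phi @: e') = ele G e e'} ->
  {in edges G, forall e : {set U}, ele H (phi @: e) f} ->
  exists S F, is_copy G H S F /\ f \in F.
Proof.
move=> max1 iso1 phi_inj fE phiN phiE phir fmax.
have [|S [F [cpy fF]]] := @copy_through_min _ _ (flip G) (flip H) emax f phi
    max1 iso1 phi_inj fE phiN phiE _ fmax.
  by move=> e e' eE eE' /=; apply: phir.
by exists S, F; split=> //; have := is_copy_flip cpy; case: cpy.
Qed.

(** * The clique with stacked copies of [G] *)

Lemma eograph_of_key {V : finType} (E : {set {set V}}) (key : {set V} -> nat) :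
  {in E, forall e : {set V}, #|e| = 2} ->
  exists2 H : eograph V, edges H = E &
    forall e e', key e < key e' -> ele H e e' /\ ~~ ele H e' e.
Proof.
move=> cardE.
(* Ties between keys are broken by [enum_rank], so [key] need not be injective. *)
pose r : rel {set V} := fun e e' =>
  (key e < key e') || (key e == key e') && (enum_rank e <= enum_rank e').
have antiE : {in E &, antisymmetric r}.
  move=> e e' _ _; rewrite /r (eq_sym (key e')).
  case: ltngtP => //= _; rewrite -eqn_leq => /eqP eqr.
  exact/enum_rank_inj/val_inj.
have transE : {in E & &, transitive r}.
  move=> e2 e1 e3 _ _ _; rewrite /r.
  case: (ltngtP (key e1) (key e2)) => //= [|-> le12].
    case: (ltngtP (key e2) (key e3)) => //= [lt23 lt12|-> -> //].
    by rewrite (ltn_trans lt12 lt23).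
  by case: ltngtP => //= _; apply: leq_trans.
have totalE : {in E &, total r}.
  move=> e e' _ _; rewrite /r.
  by case: ltngtP => //= _; apply: leq_total.
exists (EOGraph cardE antiE transE totalE) => //= e e'.
by rewrite /r; case: ltngtP.
Qed.

Definition edge_rank {U : finType} (G : eograph U) (e : {set U}) : nat :=
  #|[set e' in edges G | ele G e' e]|.

(** Down-sets are nested by transitivity, and the inclusion is strict because [e'] belongs to its
    own down-set but not to that of [e]. *)
Lemma edge_rank_lt {U : finType} (G : eograph U) :
  {in edges G &, forall e e', (edge_rank G e < edge_rank G e') = ~~ ele G e' e}.
Proof.
move=> e e' eE eE'; case: (boolP (ele G e' e)) => /= le_e'e.
  apply/negbTE; rewrite -leqNgt; apply/subset_leq_card/fintype.subsetP => d.
  rewrite !inE => /andP[dE le_de']; rewrite dE /=.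
  exact: ele_trans le_de' le_e'e.
have le_ee' : ele G e e'.
  by have := ele_total eE eE'; rewrite (negPf le_e'e) orbF.
apply/proper_card/properP; split; last first.
  by exists e'; rewrite !inE eE' ?ele_refl.
apply/fintype.subsetP => d; rewrite !inE => /andP[dE le_de]; rewrite dE /=.
exact: ele_trans le_de le_ee'.
Qed.

Lemma edge_rank_le {U : finType} (G : eograph U) (e : {set U}) :
  edge_rank G e <= #|edges G|.
Proof. by apply/subset_leq_card/fintype.subsetP => d; rewrite !inE => /andP[]. Qed.

Section Construction.
Context {U V : finType} (G : eograph U).

(* [g] places four disjoint copies of [U]; the first boolean tells the high
   copies from the low ones. *)
Context (g : U * bool * bool -> V) (g_inj : injective g).

Lemma stacked_copies :
  exists H : eograph V,
    [/\ edges H = [set e : {set V} | (#|e| == 2) && (e \subset g @: [set: _])],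
        forall b c, {in edges G &, forall e e' : {set U},
          ele H ((fun u => g (u, b, c)) @: e) ((fun u => g (u, b, c)) @: e')
          = ele G e e'} &
        forall c, {in edges G &, forall e e' : {set U},
          ele H ((fun u => g (u, false, c)) @: e)
                ((fun u => g (u, true, c)) @: e')}].
Proof.
(* Forgetting the tags recovers the edge of [G] and its rank; a high tag adds [#|edges G|.+1], more
   than any rank, which lifts high copies above low ones. The remaining clique edges may take any
   key. *)
pose key (e : {set V}) :=
  edge_rank G ((fun t => t.1.1) @: (g @^-1: e)) +
  [exists t in g @^-1: e, t.1.2] * (#|edges G|).+1.
have keyE b c (e : {set U}) : e \in edges G ->
    key ((fun u => g (u, b, c)) @: e) = edge_rank G e + b * (#|edges G|).+1.
  move=> eE; rewrite /key.
  have -> : g @^-1: ((fun u => g (u, b, c)) @: e) = (fun u => (u, b, c)) @: e.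
    by apply/finset.setP => t; rewrite inE (imset_comp g) mem_imset.
  rewrite -imset_comp imset_id; congr (_ + nat_of_bool _ * _).
  apply/exists_inP/idP => [[_ /imsetP[u _ ->]]//|bT].
  have /card_gt0P[u ue] : 0 < #|e| by rewrite (card_edge eE).
  by exists (u, b, c) => //; apply: imset_f.
have [e /[!inE] /andP[/eqP]//|H eqE Hkey] := @eograph_of_key V
  [set e : {set V} | (#|e| == 2) && (e \subset g @: [set: _])] key.
exists H; split=> // [b c e e' eE eE'|c e e' eE eE']; last first.
  have [] // := Hkey ((fun u => g (u, false, c)) @: e)
                     ((fun u => g (u, true, c)) @: e').
  rewrite !keyE // mul0n addn0 mul1n addnS ltnS.
  by rewrite (leq_trans (edge_rank_le _ _)) ?leq_addl.
have lt_key (d d' : {set U}) : d \in edges G -> d' \in edges G -> ~~ ele G d' d ->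
    key ((fun u => g (u, b, c)) @: d) < key ((fun u => g (u, b, c)) @: d').
  by move=> dE dE' Nle; rewrite !keyE // ltn_add2r edge_rank_lt.
(* Strict key inequalities settle distinct edges in both directions; equal edges need
   reflexivity. *)
have [->|eN] := eqVneq e e'.
  rewrite !ele_refl //; rewrite eqE inE; apply/andP; split.
    by rewrite card_imset ?(card_edge eE') // => u v /g_inj[].
  by apply/fintype.subsetP => _ /imsetP[u _ ->]; rewrite imset_f.
have [le_ee'|Nle] := boolP (ele G e e'); last first.
  by have [_ /negbTE] := Hkey _ _ (lt_key _ _ eE' eE Nle).
have Nle : ~~ ele G e' e.
  by apply: contra eN => le_e'e; apply/eqP/(@ele_anti _ G); rewrite // le_ee'.
by have [] := Hkey _ _ (lt_key _ _ eE eE' Nle).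
Qed.

(** The inclusion in the powerset bounds the number of edges independently of [V]. *)
Lemma stacked_copies_semisaturated (e0 emax : {set U}) :
  min_edge G e0 -> max_edge G emax ->
  isolated_edge G e0 -> isolated_edge G emax ->
  exists2 H : eograph V, semisaturated G H &
    edges H \subset powerset (g @: [set: _]).
Proof.
move=> min0 max1 iso0 iso1.
have [H [eqE Hr Hlow]] := stacked_copies.
exists H; last by rewrite eqE; apply/fintype.subsetP => e; rewrite !inE => /andP[].
have phi_inj b c : injective (fun u => g (u, b, c)) by move=> u v /g_inj[].
have phiE b c (e : {set U}) : e \in edges G -> (fun u => g (u, b, c)) @: e \in edges H.
  move=> eE; rewrite eqE inE card_imset ?(card_edge eE) //=.
  by apply/fintype.subsetP => _ /imsetP[u _ ->]; rewrite imset_f.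
move=> f [f2 fN] H' [eqE' eqr'].
have HH' : {subset edges H <= edges H'} by move=> e; rewrite eqE' !inE orbC => ->.
have fE : f \in edges H' by rewrite eqE' !inE eqxx.
(* A vertex [z] of [f] lies outside the clique, so at most one vertex of [f] lies in it. Hence one
   value of [c] gives a low and a high copy that both avoid [f]. *)
have [c cN] : exists c, forall b u, g (u, b, c) \notin f.
  move: fN; rewrite eqE inE f2 eqxx /= => /subsetPn[z zf zN].
  have fz1 : #|f :\ z| <= 1 by have := cardsD1 z f; rewrite f2 zf; lia.
  have gfz t : g t \in f -> g t \in f :\ z.
    rewrite !inE => ->; rewrite andbT.
    by apply: contraNneq zN => <-; rewrite imset_f.
  have [/existsP[b /existsP[u uf]]|none] :=
    boolP [exists b, exists u, g (u, b, false) \in f]; last first.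
    exists false => b u; apply: contra none => uf.
    by apply/existsP; exists b; apply/existsP; exists u.
  exists true => b' u'; apply/negP => uf'.
  by have /g_inj[] := card_le1_eqP fz1 _ _ (gfz _ uf) (gfz _ uf').
have phiE' b (e : {set U}) : e \in edges G -> (fun u => g (u, b, c)) @: e \in edges H'.
  by move=> eE; apply/HH'/phiE.
have phir' b : {in edges G &, forall e e' : {set U},
    ele H' ((fun u => g (u, b, c)) @: e) ((fun u => g (u, b, c)) @: e')
    = ele G e e'}.
  by move=> e e' eE eE'; rewrite eqr' ?phiE ?Hr.
(* If [f] is not below the whole high copy, it is above some high edge, hence by transitivity above
   every low edge. *)
have [/forall_inP low|/forall_inPn[e eE Nle]] :=
  boolP [forall e : {set U} in edges G, ele H' f ((fun u => g (u, true, c)) @: e)].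
  exact: (@copy_through_min _ _ _ _ _ _ _ min0 iso0 (phi_inj true c)
    fE (cN true) (phiE' true) (phir' true)).
apply: (@copy_through_max _ _ _ _ _ _ _ max1 iso1 (phi_inj false c)
    fE (cN false) (phiE' false) (phir' false)) => e' eE'.
apply: (@ele_trans _ H' ((fun u => g (u, true, c)) @: e)); rewrite ?phiE' //.
  by rewrite eqr' ?phiE ?Hlow.
by have := ele_total fE (phiE' true _ eE); rewrite (negPf Nle).
Qed.

End Construction.

(** * Bounds on [ssat_e] and their asymptotic form *)

Lemma ssat_e_le {U : finType} (G : eograph U) (n : nat) (H : eograph 'I_n) :
  semisaturated G H -> ssat_e n G <= #|edges H|.
Proof.
move=> sat; rewrite /ssat_e; case: ex_minnP => m _; apply.
by apply/asboolP; exists H.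
Qed.

Lemma ssat_e_attained {U : finType} (G : eograph U) (n : nat) :
  exists2 H : eograph 'I_n, semisaturated G H & #|edges H| = ssat_e n G.
Proof. by rewrite /ssat_e; case: ex_minnP => m /asboolP. Qed.

Lemma ssat_e_upper {U : finType} (G : eograph U) (e0 emax : {set U}) (n : nat) :
  min_edge G e0 -> max_edge G emax ->
  isolated_edge G e0 -> isolated_edge G emax ->
  #|{: U * bool * bool}| <= n -> ssat_e n G <= 2 ^ #|{: U * bool * bool}|.
Proof.
move=> min0 max1 iso0 iso1 le_n.
pose g (t : U * bool * bool) : 'I_n := widen_ord le_n (enum_rank t).
have g_inj : injective g by move=> t t' [] /val_inj /enum_rank_inj.
have [H sat sub] := stacked_copies_semisaturated g_inj min0 max1 iso0 iso1.
apply: leq_trans (ssat_e_le sat) _.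
(* Counting all subsets of the clique is crude, but the bound does not depend on [n]. *)
apply: leq_trans (subset_leq_card sub) _.
by rewrite card_powerset card_imset // cardsT.
Qed.

Lemma ssat_e_lower {U : finType} (G : eograph U) (e0 emax : {set U}) (n : nat) :
  min_edge G e0 -> max_edge G emax ->
  ~ (isolated_edge G e0 /\ isolated_edge G emax) ->
  n <= (ssat_e n G).*2.+1.
Proof.
move=> min0 max1 Niso; have [H sat <-] := ssat_e_attained G n.
by have := semisaturated_lower_bound min0 max1 Niso sat; rewrite card_ord.
Qed.


Local Open Scope classical_set_scope.
Local Open Scope ring_scope.

Theorem theorem10 (R : realType) (U : finType) (G : eograph U)
    (e0 emax : {set U}) (he0 : min_edge G e0) (hemax : max_edge G emax) :
  (isolated_edge G e0 /\ isolated_edge G emax ->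
    (fun n : nat => (ssat_e n G)%:R : R) =O_\oo (fun _ : nat => 1 : R)) /\
  (~ (isolated_edge G e0 /\ isolated_edge G emax) ->
    (fun n : nat => (ssat_e n G)%:R : R) =Omega_\oo (fun n : nat => n%:R : R)).
Proof.
split=> [[iso0 iso1]|Niso].
  apply/eqO_exP; exists (2 ^ #|{: U * bool * bool}|)%N%:R.
    by rewrite ltr0n expn_gt0.
  exists #|{: U * bool * bool}| => // n /= le_n.
  rewrite normr1 mulr1 normr_nat ler_nat.
  exact: ssat_e_upper he0 hemax iso0 iso1 le_n.
(* With [m] for [ssat_e n G], the bound is [n <= 2 * m + 1]. For [n >= 2] it forces [m >= 1], so
   [2 * m + 1 <= 3 * m]; hence the constant 3 and the threshold 2. *)
rewrite eqOmegaE eqOmegaO; apply/eqO_exP; exists 3%:R; first by rewrite ltr0n.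
exists 2%N => // n /= n_ge2.
rewrite !normr_nat -natrM ler_nat.
have := ssat_e_lower n he0 hemax Niso; move: n_ge2.
case: (ssat_e n G) => [|m] n_ge2 n_le; first by have := leq_trans n_ge2 n_le.
by apply: leq_trans n_le _; lia.
Qed.
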